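(* Let a network $f$ and a transformed network $f^\dagger$ be given, where the invertible matrices $\Omega_i,\Phi_i$ defining the transformation remain fixed, and let $\zeta$ be the associated reparameterization map (all as in the context). The optimization path taken by K-FAC (using either of the Fisher approximations $\breve F$ or $\hat F$) through the space of predictive distributions is the same for the original (default) network as it is for the transformed network. This assumes the use of an equivalent initialization, $\theta_0=\zeta(\theta_0^\dagger)$, and a basic version of K-FAC where damping is absent or negligible in effect, momentum is not used, and where the learning rates are chosen in a way that is independent of the network's parameterization.
   Context: **Original network.** Layer sizes $d_0,\dots,d_\ell$. For a vector $a$, $\bar a$ denotes $a$ with an extra last coordinate equal to $1$. Given an input $x$, set $a_0=x$ and, for $i=1,\dots,\ell$, $s_i=W_i\bar a_{i-1}$, $a_i=\phi_i(s_i)$, where $W_i\in\mathbb{R}^{d_i\times(d_{i-1}+1)}$ and $\phi_i$ is an element-wise nonlinearity. The output is $f(x,\theta)=a_\ell$, where $\theta=[\mathrm{vec}(W_1)^\top\cdots\mathrm{vec}(W_\ell)^\top]^\top$ and $\mathrm{vec}$ stacks the columns of a matrix. **Loss and objective.** $L(y,z)=-\log r(y|z)$, where $r(\cdot|z)$ is the density of a predictive distribution $R_{y|z}$. The network defines the conditional model (its predictive distribution) $P_{y|x}(\theta)=R_{y|f(x,\theta)}$. $h(\theta)$ is the expectation of $L(y,f(x,\theta))$ over $(x,y)$ drawn from a training distribution $\hat Q_{x,y}$, whose marginal on inputs is $\hat Q_x$; $\nabla h$ is its gradient in $\theta$. **Fisher approximations.** Let $g_i$ be the gradient of $L(y,f(x,\theta))$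 with respect to $s_i$. Below, $\mathrm{E}$ is taken over $x\sim\hat Q_x$ and $y\sim P_{y|x}(\theta)$ (the model's distribution). Put $\bar A_{i,j}=\mathrm{E}[\bar a_i\bar a_j^\top]$, $G_{i,j}=\mathrm{E}[g_ig_j^\top]$, and $\tilde F_{i,j}=\bar A_{i-1,j-1}\otimes G_{i,j}$ for $1\le i,j\le\ell$ ($\otimes$ the Kronecker product). - $\breve F=\mathrm{diag}(\tilde F_{1,1},\dots,\tilde F_{\ell,\ell})$ (block-diagonal). - $\hat F$ is the matrix agreeing with the block matrix $(\tilde F_{i,j})$ on the tridiagonal blocks and whose inverse is block-tridiagonal. Explicitly, $\hat F^{-1}=\Xi^\top\Lambda\Xi$, where $\Psi_{i,i+1}=\tilde F_{i,i+1}\tilde F_{i+1,i+1}^{-1}$, $\Sigma_{i|i+1}=\tilde F_{i,i}-\Psi_{i,i+1}\tilde F_{i+1,i+1}\Psi_{i,i+1}^\top$ for $1\le i\le \ell-1$, $\Sigma_\ell=\tilde F_{\ell,\ell}$, $\Lambda=\mathrm{diag}(\Sigma_{1|2}^{-1},\dots,\Sigma_{\ell-1|\ell}^{-1},\Sigma_\ell^{-1})$, and $\Xi$ is the block upper-bidiagonal matrix with identity diagonal blocks and $(i,i+1)$ block equal to $-\Psi_{i,i+1}$. **K-FAC.** K-FAC (Kronecker-factored Approximate Curvature) is an iterative optimization method for $h$ which, in its basic version, additively updates the current parameters $\theta$ by $\delta=-\alpha C^{-1}\nabla h$, where $C$ is $\breve F$ or $\hat F$ and $\alpha$ is a learning rate.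 The full method additionally uses damping (e.g. Tikhonov regularization: adding multiples of the identity to the Kronecker factors $\bar A_{i-1,i-1}$ and $G_{i,i}$ before inversion) and momentum (adding to the update a multiple of the previous update). For the transformed network the method acts in the same way on $\theta^\dagger$, with updates $-\alpha (C^\dagger)^{-1}\nabla h^\dagger$, where $C^\dagger$ is $\breve F^\dagger$ or $\hat F^\dagger$ respectively. **Transformed network.** Let $\bar\phi_i(s)$ be $\phi_i(s)$ with an extra last coordinate $1$. Let $\Omega_i$ ($0\le i\le\ell$, size $(d_i+1)\times(d_i+1)$) and $\Phi_i$ ($1\le i\le\ell$, size $d_i\times d_i$) be arbitrary invertible matrices, except that $\Omega_\ell=I$. With $\bar a_0^\dagger=\Omega_0\bar a_0$, define for $i=1,\dots,\ell$: $s_i^\dagger=W_i^\dagger\bar a_{i-1}^\dagger$, $\bar a_i^\dagger=\Omega_i\bar\phi_i(\Phi_is_i^\dagger)$. Let $a_i^\dagger$ be $\bar a_i^\dagger$ without its last coordinate. The output is $f^\dagger(x,\theta^\dagger)=a_\ell^\dagger$, where $\theta^\dagger=[\mathrm{vec}(W_1^\dagger)^\top\cdots\mathrm{vec}(W_\ell^\dagger)^\top]^\top$, and the predictive distribution is $R_{y|f^\dagger(x,\theta^\dagger)}$. A superscript $\dagger$ on any network-dependent quantity ($h$, $\nabla h$, $g_i$, $\bar A_{i,j}$, $G_{i,j}$, $\breve F$, $\hat F$) denotes the analogous quantity computed from the transformed network, with gradients taken with respect to $\theta^\dagger$ or $s_i^\dagger$. **The map $\zeta$.** $\zeta$ is the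 invertible linear map $\theta^\dagger\mapsto\theta$ given by $W_i=\Phi_iW_i^\dagger\Omega_{i-1}$, $1\le i\le\ell$; it satisfies $f^\dagger(x,\theta^\dagger)=f(x,\zeta(\theta^\dagger))$. The matrices inverted above are taken to be invertible. *)

(* Defs.v *)
From HB Require Import structures.
From mathcomp Require Import all_boot all_order all_algebra.
From mathcomp Require Import mxtens.
From mathcomp Require Import all_classical all_reals all_analysis.

Set Implicit Arguments.
Unset Strict Implicit.
Unset Printing Implicit Defensive.

Import Order.TTheory GRing.Theory Num.Theory.
Import numFieldNormedType.Exports.

Local Open Scope classical_set_scope.
Local Open Scope ring_scope.

Section Vectors.
Context {R : realType}.

(* With mxtens_index (j, k) = j * m + k, the vector [vec W] stacks the columns
   of W, and (A *t B) *m vec W = vec (B *m W *m A^T) for the Kronecker product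
   A *t B of mxtens. *)
Definition vec m n (W : 'M[R]_(m, n)) : 'cV[R]_(n * m) :=
  \col_l W (mxtens_unindex l).2 (mxtens_unindex l).1.

Definition unvec m n (v : 'cV[R]_(n * m)) : 'M[R]_(m, n) :=
  \matrix_(k, j) v (mxtens_index (j, k)) 0.

Definition bar n (a : 'cV[R]_n) : 'cV[R]_(n + 1) := col_mx a (const_mx 1).

Definition unbar n (a : 'cV[R]_(n + 1)) : 'cV[R]_n := usubmx a.

Definition gradient n (F : 'cV[R]_n -> R) (v : 'cV[R]_n) : 'cV[R]_n :=
  \col_i 'D_(delta_mx i 0) F v.

End Vectors.

HB.instance Definition _ (d1 d2 : measure_display) (T1 : measurableType d1)
    (T2 : measurableType d2) :=
  isMeasurableFun.Build _ _ (T1 * T2)%type T1 fst measurable_fst.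

(* R^n with its Borel sigma-algebra. *)
Definition borel_cV (R : realType) (n : nat) :=
  g_sigma_algebraType (@open 'cV[R]_n).

(* The weight matrix W_{i+1} is numbered by i = 0, ..., l - 1. *)
Section Architectures.
Context {R : realType}.
Variables (l : nat) (d : nat -> nat).

Definition block_size (i : nat) : nat := ((d i + 1) * d i.+1)%N.

Definition nparams : nat := (\sum_(i < l) block_size i)%N.

(* Total in i, with the value 0 for i >= l, so that layers can be traversed by
   recursion on nat. *)
Definition weight (theta : 'cV[R]_nparams) (i : nat) :
    'M[R]_(d i.+1, d i + 1) :=
  match @idP (i < l)%N with
  | ReflectT lt_il =>
      unvec (submxcol (p_ := fun j : 'I_l => block_size j) theta
               (Ordinal lt_il))
  | ReflectF _ => 0
  end.

Definition param_of_weights (W : forall i, 'M[R]_(d i.+1, d i + 1)) :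
    'cV[R]_nparams :=
  \mxcol_(i < l) vec (W i).

(* A network architecture is given by the maps s_i |-> \bar a_i for i >= 1,
   and by the map x |-> \bar a_0 for i = 0. *)
Definition architecture := forall i, 'cV[R]_(d i) -> 'cV[R]_(d i + 1).

Definition original_arch (phi : nat -> R -> R) : architecture :=
  fun i => if i is 0 then fun x => bar x else fun s => bar (map_mx (phi i) s).

Definition transformed_arch (phi : nat -> R -> R)
    (Omega : forall i, 'M[R]_(d i + 1)) (Phi : forall i, 'M[R]_(d i)) :
    architecture :=
  fun i => if i is 0 then fun x => Omega i *m bar x
           else fun s => Omega i *m bar (map_mx (phi i) (Phi i *m s)).

Definition zeta (Omega : forall i, 'M[R]_(d i + 1))
    (Phi : forall i, 'M[R]_(d i)) (theta' : 'cV[R]_nparams) :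
    'cV[R]_nparams :=
  param_of_weights (fun i => Phi i.+1 *m weight theta' i *m Omega i).

End Architectures.

Arguments original_arch {R d} phi.
Arguments transformed_arch {R d} phi Omega Phi.
Arguments zeta {R l d} Omega Phi theta'.

Section Network.
Context {R : realType} {l : nat} {d : nat -> nat}.
Variable net : @architecture R d.
Notation param := 'cV[R]_(nparams l d).

(* The computation of \bar a_i in which s_k is replaced by v whenever
   [c k = Some v]; the later layers are computed from the replaced value. *)
Fixpoint clamped_act (theta : param) (c : forall k, option 'cV[R]_(d k))
    (x : 'cV[R]_(d 0%N)) (i : nat) : 'cV[R]_(d i + 1) :=
  match i with
  | 0 => net x
  | k.+1 => net (odflt (weight theta k *m clamped_act theta c x k) (c k.+1))
  end.

Definition no_clamp : forall k, option 'cV[R]_(d k) := fun=> None.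

Definition act (theta : param) (x : 'cV[R]_(d 0%N)) (i : nat) :=
  clamped_act theta no_clamp x i.

(* s_{i+1} = W_{i+1} \bar a_i. *)
Definition preact (theta : param) (x : 'cV[R]_(d 0%N)) (i : nat) :
    'cV[R]_(d i.+1) := weight theta i *m act theta x i.

Definition output (theta : param) (x : 'cV[R]_(d 0%N)) : 'cV[R]_(d l) :=
  unbar (act theta x l).

(* The output as a function of s_{i+1}, the parameters and x being fixed. *)
Definition output_of_preact (theta : param) (x : 'cV[R]_(d 0%N)) (i : nat)
    (s : 'cV[R]_(d i.+1)) : 'cV[R]_(d l) :=
  unbar (clamped_act theta (@dfwith _ _ no_clamp i.+1 (Some s)) x l).

End Network.

Section Loss.
Context {R : realType} {dY : measure_display} {Y : measurableType dY} {n : nat}.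

(* [r y z] is the density r(y|z) of [Rdist z] with respect to [mu]. *)
Definition is_density (mu : {measure set Y -> \bar R})
    (Rdist : 'cV[R]_n -> probability Y R) (r : Y -> 'cV[R]_n -> R) : Prop :=
  forall z, [/\ measurable_fun setT (r ^~ z), (forall y, 0 <= r y z)
    & forall A, measurable A ->
        Rdist z A = (\int[mu]_(y in A) (r y z)%:E)%E].

(* Since ln 0 = 0 in the library, this is the loss only where r y z > 0, hence
   almost surely for y drawn from the predictive distribution. *)
Definition nll (r : Y -> 'cV[R]_n -> R) (y : Y) (z : 'cV[R]_n) : R :=
  - ln (r y z).

End Loss.

Section KFAC.
Context {R : realType} {l : nat} {d : nat -> nat}.
Context {dY : measure_display} {Y : measurableType dY}.
Variables (Rdist : 'cV[R]_(d l) -> probability Y R).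
Variables (r : Y -> 'cV[R]_(d l) -> R).
Variables (Q : probability (borel_cV R (d 0%N) * Y)%type R).
Variable net : @architecture R d.
Notation param := 'cV[R]_(nparams l d).

Definition input_marginal : probability (borel_cV R (d 0%N)) R :=
  distribution Q fst.

Definition cond_model (theta : param) (x : 'cV[R]_(d 0%N)) : probability Y R :=
  Rdist (output net theta x).

Definition objective (theta : param) : R :=
  \int[Q]_(p in setT) nll r p.2 (output net theta p.1).

Definition model_expectation (theta : param) (F : 'cV[R]_(d 0%N) -> Y -> R) : R :=
  \int[input_marginal]_(x in setT) \int[cond_model theta x]_(y in setT) F x y.

Definition has_model_expectation (theta : param) (F : 'cV[R]_(d 0%N) -> Y -> R) :
    Prop :=
  {ae input_marginal, forall x,
     (cond_model theta x).-integrable setT (EFin \o F x)} /\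
  input_marginal.-integrable setT
    (fun x => (\int[cond_model theta x]_(y in setT) F x y)%:E).

Definition loss_of_preact (theta : param) (x : 'cV[R]_(d 0%N)) (y : Y) (i : nat)
    (s : 'cV[R]_(d i.+1)) : R :=
  nll r y (output_of_preact net theta x s).

(* [g theta x y i] is the gradient g_{i+1} of the loss with respect to
   s_{i+1}; accordingly [Gmat i j] is G_{i+1,j+1} and [Ftilde i j] is
   \tilde F_{i+1,j+1}, whereas [Abar i j] is \bar A_{i,j}. *)
Definition g (theta : param) (x : 'cV[R]_(d 0%N)) (y : Y) (i : nat) :
    'cV[R]_(d i.+1) :=
  gradient (@loss_of_preact theta x y i) (preact net theta x i).

Definition Abar (theta : param) (i j : nat) : 'M[R]_(d i + 1, d j + 1) :=
  \matrix_(k, m) model_expectation theta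
    (fun x _ => (act net theta x i *m (act net theta x j)^T) k m).

Definition Gmat (theta : param) (i j : nat) : 'M[R]_(d i.+1, d j.+1) :=
  \matrix_(k, m) model_expectation theta
    (fun x y => (g theta x y i *m (g theta x y j)^T) k m).

Definition Ftilde (theta : param) (i j : nat) :
    'M[R]_(block_size d i, block_size d j) :=
  tensmx (Abar theta i j) (Gmat theta i j).

Definition Fbreve (theta : param) : 'M[R]_(nparams l d) :=
  \mxdiag_(i < l) Ftilde theta i i.

Definition Psi (theta : param) (i j : nat) :
    'M[R]_(block_size d i, block_size d j) :=
  Ftilde theta i j *m invmx (Ftilde theta j j).

(* \Sigma_{i+1|i+2} for i.+1 < l, and \Sigma_l for i.+1 = l. *)
Definition Sigma (theta : param) (i : nat) : 'M[R]_(block_size d i) :=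
  if (i.+1 < l)%N then
    Ftilde theta i i
      - Psi theta i i.+1 *m Ftilde theta i.+1 i.+1 *m (Psi theta i i.+1)^T
  else Ftilde theta i i.

Definition Lambda (theta : param) : 'M[R]_(nparams l d) :=
  \mxdiag_(i < l) invmx (Sigma theta i).

Definition Xi (theta : param) : 'M[R]_(nparams l d) :=
  1%:M - \mxblock_(i < l, j < l) (if j == i.+1 :> nat then Psi theta i j else 0).

Definition Fhat (theta : param) : 'M[R]_(nparams l d) :=
  invmx ((Xi theta)^T *m Lambda theta *m Xi theta).

Variant fisher_approx := BlockDiagonal | BlockTridiagonal.

Definition curvature (c : fisher_approx) : param -> 'M[R]_(nparams l d) :=
  match c with
  | BlockDiagonal => Fbreve
  | BlockTridiagonal => Fhat
  end.

Definition inverses_exist (c : fisher_approx) (theta : param) : Prop :=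
  match c with
  | BlockDiagonal => Fbreve theta \in unitmx
  | BlockTridiagonal =>
      (forall i, (i.+1 < l)%N -> Ftilde theta i.+1 i.+1 \in unitmx) /\
      (forall i, (i < l)%N -> Sigma theta i \in unitmx)
  end.

(* The gradients and the expectations that enter the update at theta exist. *)
Definition update_defined (theta : param) : Prop :=
  [/\ differentiable objective theta,
      {ae input_marginal, forall x, {ae cond_model theta x, forall y,
        forall i, (i < l)%N ->
          differentiable (@loss_of_preact theta x y i) (preact net theta x i)}},
      (forall i j (k : 'I_(d i + 1)) (m : 'I_(d j + 1)),
        (i < l)%N -> (j < l)%N ->
        has_model_expectation theta
          (fun x _ => (act net theta x i *m (act net theta x j)^T) k m))
    & (forall i j (k : 'I_(d i.+1)) (m : 'I_(d j.+1)),
        (i < l)%N -> (j < l)%N ->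
        has_model_expectation theta
          (fun x y => (g theta x y i *m (g theta x y j)^T) k m))].

Definition kfac_step (c : fisher_approx) (alpha : R) (theta : param) : param :=
  theta - alpha *: (invmx (curvature c theta) *m gradient objective theta).

(* The learning rate may depend on everything seen so far in the space of
   functions computed by the network: [lr] is given, for each iteration up to
   the current one, the function computed after an update with an arbitrary
   learning rate (0 giving the current function). This covers
   constant rates, schedules in the iteration number and line searches. *)
Definition learning_rule :=
  seq (R -> 'cV[R]_(d 0%N) -> 'cV[R]_(d l)) -> R.

Definition kfac_run (lr : learning_rule) (c : fisher_approx)
    (theta : nat -> param) : Prop :=
  forall k, theta k.+1 =
    kfac_step c
      (lr (mkseq (fun j alpha => output net (kfac_step c alpha (theta j))) k.+1))
      (theta k).

End KFAC.

(* Main.v *)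
(** Write zeta as theta = D^T theta', where D is block diagonal with blocks
    D_i = Omega_i *t Phi_{i+1}^T.  Since \bar a_i^dag = Omega_i \bar a_i and, by
    the chain rule, g_i^dag = Phi_i^T g_i, the Fisher blocks satisfy
    Ftilde^dag_{ij} = D_i Ftilde_{ij} D_j^T, hence the curvature matrices
    satisfy C^dag = D C D^T, while grad h^dag = D grad h.  Thus
    D^T (C^dag)^-1 grad h^dag = C^-1 grad h, so zeta maps K-FAC steps to K-FAC
    steps with the same learning rate. *)

Require Import Defs.
From HB Require Import structures.
From mathcomp Require Import all_boot all_order all_algebra.
From mathcomp Require Import mxtens.
From mathcomp Require Import all_classical all_reals all_analysis.
From mathcomp Require Import measurable_realfun.

Set Implicit Arguments.
Unset Strict Implicit.
Unset Printing Implicit Defensive.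

Import Order.TTheory GRing.Theory Num.Theory.
Import numFieldNormedType.Exports.

Local Open Scope classical_set_scope.
Local Open Scope ring_scope.

(** * Integrals of almost everywhere equal functions *)

Section AlmostEverywhereEqual.
Context {dT : measure_display} {T : measurableType dT} {R : realType}.
Variable mu : {measure set T -> \bar R}.

Import HBNNSimple.

(** A simple function below [f1], set to zero on the exceptional null set, lies below [f2] and keeps
    its integral. *)
Lemma ae_le_integral (f1 f2 : T -> \bar R) :
  (forall x, 0 <= f1 x)%E -> (forall x, 0 <= f2 x)%E ->
  {ae mu, forall x, (f1 x <= f2 x)%E} ->
  (\int[mu]_x f1 x <= \int[mu]_x f2 x)%E.
Proof.
move=> f1_ge0 f2_ge0 [N [mN muN0 N_sub]].
rewrite !ge0_integralTE//; apply: ge_ereal_sup => _ [h /= h_le <-].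
have mNC : measurable (~` N) by exact: measurableC.
apply: le_ereal_sup_tmp; exists (sintegral mu (proj_nnsfun h mNC)); last first.
  rewrite -!integralT_nnsfun le_eqVlt; apply/orP; left.
  apply/eqP/ae_eq_integral => //.
  - by apply/measurable_EFinP; exact: measurable_funPT.
  - by apply/measurable_EFinP; exact: measurable_funPT.
  exists N; split=> // x /=; apply: contra_notP => Nx _.
  by rewrite /= mindicE mem_set// mulr1.
exists (proj_nnsfun h mNC) => // x /=; rewrite mindicE.
have [|_] := boolP (x \in ~` N); last by rewrite mulr0.
rewrite inE mulr1 => Nx; apply: (le_trans (h_le x)).
by apply: contrapT => lt_f; apply: Nx; exact: N_sub.
Qed.

(* Unlike [ae_eq_integral], no measurability is required: the integral of a
   nonnegative function is a supremum over the simple functions below it. *)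
Lemma ae_eq_integral_nomeas (f1 f2 : T -> \bar R) :
  {ae mu, forall x, f1 x = f2 x} -> (\int[mu]_x f1 x = \int[mu]_x f2 x)%E.
Proof.
move=> f12; rewrite integralE [RHS]integralE; congr (_ - _)%E.
  apply/eqP; rewrite eq_le; apply/andP; split; apply: ae_le_integral => //;
    by apply: filterS f12 => x; rewrite !funeposE => ->.
apply/eqP; rewrite eq_le; apply/andP; split; apply: ae_le_integral => //;
  by apply: filterS f12 => x; rewrite !funenegE => ->.
Qed.

Lemma ae_eq_Rintegral (f1 f2 : T -> R) :
  {ae mu, forall x, f1 x = f2 x} -> \int[mu]_x f1 x = \int[mu]_x f2 x.
Proof.
move=> f12; congr fine; apply: ae_eq_integral_nomeas.
by apply: filterS f12 => x ->.
Qed.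

Lemma Rintegral_linear_comb (I : finType) (a : I -> R) (f : I -> T -> R) :
  (forall i, mu.-integrable setT (EFin \o f i)) ->
  \int[mu]_x (\sum_i a i * f i x) = \sum_i a i * \int[mu]_x f i x.
Proof.
move=> int_f.
have int_af i : mu.-integrable setT (EFin \o (fun x => a i * f i x)).
  by apply: eq_integrable (integrableZl measurableT (a i) (int_f i)).
rewrite /Rintegral.
under eq_integral do rewrite -sumEFin.
rewrite integral_sum// -sum_fine => [|i _].
  by apply: eq_bigr => i _; exact: RintegralZl.
exact/integrable_fin_num/int_af.
Qed.

End AlmostEverywhereEqual.

(** * Kronecker products and column stacking *)

Section KroneckerProduct.
Context {R : realType}.

Lemma tens_mx1 m n : tensmx (1%:M : 'M[R]_m) (1%:M : 'M[R]_n) = 1%:M.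
Proof.
apply/matrixP => i j.
case: (mxtens_indexP i) => i1 i2; case: (mxtens_indexP j) => j1 j2.
rewrite tensmxE !mxE -natrM mulnb (can_eq (@mxtens_indexK m n)).
by rewrite xpair_eqE.
Qed.

Lemma tens_unitmx m n (A : 'M[R]_m) (B : 'M[R]_n) :
  A \in unitmx -> B \in unitmx -> tensmx A B \in unitmx.
Proof.
move=> uA uB.
have := tensmx_mul A B (invmx A) (invmx B).
by rewrite !mulmxV// tens_mx1 => /mulmx1_unit[].
Qed.

Lemma vecK m n : cancel (@vec R m n) (@unvec R m n).
Proof. by move=> W; apply/matrixP => i j; rewrite !mxE mxtens_indexK. Qed.

Lemma unvecK m n : cancel (@unvec R m n) (@vec R m n).
Proof.
move=> v; apply/matrixP => i j.
rewrite [j]ord1 !mxE; congr (v _ _); rewrite -[RHS]mxtens_unindexK.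
by congr mxtens_index; case: mxtens_unindex.
Qed.

Lemma vec_mulmx m n p q (B : 'M[R]_(p, m)) (W : 'M[R]_(m, n))
    (A : 'M[R]_(q, n)) :
  tensmx A B *m vec W = vec (B *m W *m A^T).
Proof.
apply/matrixP => i j; rewrite [j]ord1 {j}.
case: (mxtens_indexP i) => i1 i2; rewrite !mxE mxtens_indexK /=.
(* The flat index of [vec W] is split into a column and a row index, which turns the product into a
   double sum. *)
rewrite (reindex (@mxtens_index n m)) /=; last first.
  by exists (@mxtens_unindex n m) => k _;
    rewrite (mxtens_indexK, mxtens_unindexK).
transitivity (\sum_k1 \sum_k2 A i1 k1 * B i2 k2 * W k2 k1).
  rewrite pair_big; apply: eq_bigr => -[k1 k2] _ /=.
  by rewrite tensmxE mxE mxtens_indexK.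
apply: eq_bigr => k1 _; rewrite !mxE big_distrl /=; apply: eq_bigr => k2 _.
by rewrite -mulrA mulrC.
Qed.

End KroneckerProduct.

(** * Congruence and conjugation of square matrices *)

Section Congruence.
Context {R : realType}.

Lemma congr_unitmx n (J M : 'M[R]_n) :
  J \in unitmx -> M \in unitmx -> J *m M *m J^T \in unitmx.
Proof. by move=> uJ uM; rewrite !unitmx_mul uJ uM unitmx_tr. Qed.

Lemma invmx_congr n (J M : 'M[R]_n) : J \in unitmx -> M \in unitmx ->
  invmx (J *m M *m J^T) = (invmx J)^T *m invmx M *m invmx J.
Proof.
move=> uJ uM; have uJM := congr_unitmx uJ uM.
apply: (can_inj (mulKmx uJM)); rewrite mulmxV// trmx_inv.
by rewrite !mulmxA mulmxK ?unitmx_tr// mulmxK// mulmxV.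
Qed.

Lemma mulmx_tr_conj n (D X L : 'M[R]_n) : D \in unitmx ->
  (D *m X *m invmx D)^T *m ((invmx D)^T *m L *m invmx D)
    *m (D *m X *m invmx D) =
  (invmx D)^T *m (X^T *m L *m X) *m invmx D.
Proof.
move=> uD; have uDt : D^T \in unitmx by rewrite unitmx_tr.
by rewrite !trmx_mul !trmx_inv !mulmxA mulmxK// mulmxKV.
Qed.

End Congruence.

(** * Products and inverses of block-diagonal matrices *)

Section BlockDiagonal.
Context {R : realType} {l : nat} {p_ : 'I_l -> nat}.
Implicit Types A B : forall i : 'I_l, 'M[R]_(p_ i).

Lemma mul_mxdiag A B :
  \mxdiag_i A i *m \mxdiag_i B i = \mxdiag_i (A i *m B i).
Proof.
rewrite {2}/mxdiag mul_mxdiag_mxblock /mxdiag; apply/eq_mxblock => i j.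
case: eqVneq => [eq_ij|]; rewrite ?mulmx0//.
(* [\mxdiag] casts its diagonal blocks with [conform_mx]; once [i] and [j] are identified the casts
   are identities. *)
by case: j / eq_ij; rewrite !conform_mx_id.
Qed.

Lemma mxdiag_mulmxV A : (forall i, A i \in unitmx) ->
  \mxdiag_i A i *m \mxdiag_i invmx (A i) = 1%:M.
Proof.
move=> uA; rewrite mul_mxdiag -mxdiagZ.
by apply/eq_mxdiag => i; rewrite mulmxV.
Qed.

Lemma mxdiag_unitmx A :
  (forall i, A i \in unitmx) -> \mxdiag_i A i \in unitmx.
Proof. by move=> /mxdiag_mulmxV/mulmx1_unit[]. Qed.

Lemma invmx_mxdiag A : (forall i, A i \in unitmx) ->
  invmx (\mxdiag_i A i) = \mxdiag_i invmx (A i).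
Proof.
move=> uA; rewrite -[LHS]mulmx1 -(mxdiag_mulmxV uA) mulKmx//.
exact: mxdiag_unitmx.
Qed.

End BlockDiagonal.

(** * Transformation of the curvature matrices *)

Lemma invmx_Fhat (R : realType) (l : nat) (d : nat -> nat)
    (dY : measure_display) (Y : measurableType dY)
    (Rdist : 'cV[R]_(d l) -> probability Y R) (r : Y -> 'cV[R]_(d l) -> R)
    (Q : probability (borel_cV R (d 0%N) * Y)%type R)
    (net : @architecture R d) (theta : 'cV[R]_(nparams l d)) :
  invmx (Fhat Rdist r Q net theta) =
  (Xi Rdist r Q net theta)^T *m Lambda Rdist r Q net theta
    *m Xi Rdist r Q net theta.
(* [invmx] fixes singular matrices, hence is an involution on all square matrices. *)
Proof. exact: invmxK. Qed.

(* [J i] plays the role of D_i. *)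
Section CurvatureCongruence.
Context {R : realType} {l : nat} {d : nat -> nat}.
Context {dY : measure_display} {Y : measurableType dY}.
Variables (Rdist : 'cV[R]_(d l) -> probability Y R).
Variables (r : Y -> 'cV[R]_(d l) -> R).
Variables (Q : probability (borel_cV R (d 0%N) * Y)%type R).
Variables net net' : @architecture R d.
Variables theta theta' : 'cV[R]_(nparams l d).
Variable J : forall i, 'M[R]_(block_size d i).
Hypothesis J_unit : forall i, (i < l)%N -> J i \in unitmx.
Notation F := (Ftilde Rdist r Q net theta).
Notation F' := (Ftilde Rdist r Q net' theta').
Hypothesis F'E : forall i j, (i < l)%N -> (j < l)%N ->
  F' i j = J i *m F i j *m (J j)^T.

Let D : 'M[R]_(nparams l d) := \mxdiag_(i < l) J i.

Let D_unit : D \in unitmx.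
Proof. by apply: mxdiag_unitmx => i; exact: J_unit. Qed.

Lemma Fbreve_congr :
  Fbreve Rdist r Q net' theta' = D *m Fbreve Rdist r Q net theta *m D^T.
Proof.
rewrite /D tr_mxdiag !mul_mxdiag; apply/eq_mxdiag => i.
exact: F'E.
Qed.

(** The right factor [(J i.+1)^T] of the off-diagonal block cancels against the inverse of the
    diagonal block, so [Psi] transforms as a linear map and not as a bilinear form. *)
Lemma Psi_congr i : (i.+1 < l)%N -> F i.+1 i.+1 \in unitmx ->
  Psi Rdist r Q net' theta' i i.+1 =
  J i *m Psi Rdist r Q net theta i i.+1 *m invmx (J i.+1).
Proof.
move=> lt_il uF; rewrite /Psi (F'E (ltnW lt_il) lt_il) (F'E lt_il lt_il).
have uJ := J_unit lt_il.
by rewrite invmx_congr// trmx_inv !mulmxA mulmxK// unitmx_tr.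
Qed.

(** Before the last layer [Sigma] is a Schur complement, and the factors [J i.+1] cancel in its
    subtracted term; at the last layer it is the diagonal block itself. *)
Lemma Sigma_congr i : (i < l)%N ->
  ((i.+1 < l)%N -> F i.+1 i.+1 \in unitmx) ->
  Sigma Rdist r Q net' theta' i = J i *m Sigma Rdist r Q net theta i *m (J i)^T.
Proof.
move=> lt_il uF; rewrite /Sigma; have [lt_i1l|_] := ltnP i.+1 l;
  last exact: (F'E lt_il lt_il).
have uJ := J_unit lt_i1l.
rewrite (Psi_congr lt_i1l (uF lt_i1l)) (F'E lt_il lt_il) (F'E lt_i1l lt_i1l).
rewrite mulmxBr mulmxBl; congr (_ - _).
by rewrite !trmx_mul trmx_inv !mulmxA mulmxKV// mulmxK// unitmx_tr.
Qed.

Hypothesis inv_tri :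
  inverses_exist Rdist r Q net BlockTridiagonal theta.

Lemma Lambda_congr : Lambda Rdist r Q net' theta' =
  (invmx D)^T *m Lambda Rdist r Q net theta *m invmx D.
Proof.
have [uF uS] := inv_tri.
rewrite /D invmx_mxdiag; last by move=> i; exact: J_unit.
rewrite tr_mxdiag !mul_mxdiag; apply/eq_mxdiag => i.
by rewrite Sigma_congr ?invmx_congr ?uS// ?J_unit//; exact: uF.
Qed.

Lemma Xi_congr : Xi Rdist r Q net' theta' =
  D *m Xi Rdist r Q net theta *m invmx D.
Proof.
have [uF uS] := inv_tri.
(* With [invmx D] moved to the other side, both identity parts give [D], and only the superdiagonal
   blocks remain to be compared. *)
apply: (canRL (mulmxK D_unit)); rewrite /Xi mulmxBl mulmxBr mul1mx mulmx1.
congr (_ - _); rewrite mul_mxblock_mxdiag mul_mxdiag_mxblock.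
apply/eq_mxblock => i j; case: eqP => [eq_ji|_]; last by rewrite mul0mx mulmx0.
(* The bound comes from [j], an ordinal below [l]. *)
have lt_i1l : (i.+1 < l)%N by rewrite -eq_ji.
by rewrite eq_ji Psi_congr ?uF// mulmxKV// J_unit.
Qed.

Lemma invmx_Fhat_congr : invmx (Fhat Rdist r Q net' theta') =
  (invmx D)^T *m invmx (Fhat Rdist r Q net theta) *m invmx D.
Proof.
transitivity ((invmx D)^T *m ((Xi Rdist r Q net theta)^T
    *m Lambda Rdist r Q net theta *m Xi Rdist r Q net theta) *m invmx D).
  apply: (etrans (invmx_Fhat Rdist r Q net' theta')).
  by rewrite Xi_congr Lambda_congr mulmx_tr_conj.
congr (_ *m _ *m _); exact/esym/invmx_Fhat.
Qed.

End CurvatureCongruence.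

(** Phrased for the inverse, which is what enters an update and what the factors [Xi] and [Lambda]
    describe directly. *)
Lemma invmx_curvature_congr (R : realType) (l : nat) (d : nat -> nat)
    (dY : measure_display) (Y : measurableType dY)
    (Rdist : 'cV[R]_(d l) -> probability Y R) (r : Y -> 'cV[R]_(d l) -> R)
    (Q : probability (borel_cV R (d 0%N) * Y)%type R)
    (net net' : @architecture R d) (theta theta' : 'cV[R]_(nparams l d))
    (J : forall i, 'M[R]_(block_size d i)) (c : fisher_approx) :
  (forall i, (i < l)%N -> J i \in unitmx) ->
  (forall i j, (i < l)%N -> (j < l)%N ->
    Ftilde Rdist r Q net' theta' i j =
    J i *m Ftilde Rdist r Q net theta i j *m (J j)^T) ->
  inverses_exist Rdist r Q net c theta ->
  let D : 'M[R]_(nparams l d) := \mxdiag_(i < l) J i in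
  invmx (curvature Rdist r Q net' c theta') =
  (invmx D)^T *m invmx (curvature Rdist r Q net c theta) *m invmx D.
Proof.
move=> uJ F'E inv_c D.
have uD : D \in unitmx by apply: mxdiag_unitmx => i; exact: uJ.
case: c inv_c => /= inv_c.
  by rewrite (Fbreve_congr F'E) (invmx_congr uD inv_c).
exact: invmx_Fhat_congr.
Qed.

(** * Parameter vectors and their weight matrices *)

Section WeightVectors.
Context {R : realType} {l : nat} {d : nat -> nat}.

Lemma weight_param_of_weights (W : forall i, 'M[R]_(d i.+1, d i + 1)) i :
  (i < l)%N -> weight (param_of_weights l W) i = W i.
Proof.
(* [weight] matches on a proof of [i < l]; the bound at hand rules out the zero branch. *)
move=> lt_il; rewrite /weight; case: {-}_ / idP => // lt_il'.
by rewrite /param_of_weights mxcolK vecK.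
Qed.

Lemma weight_ge (theta : 'cV[R]_(nparams l d)) i :
  (l <= i)%N -> weight theta i = 0.
Proof. by rewrite leqNgt /weight; case: {-}_ / idP => // lt_il /negP. Qed.

Lemma param_of_weightsK (theta : 'cV[R]_(nparams l d)) :
  param_of_weights l (weight theta) = theta.
Proof.
rewrite -[RHS]submxcolK; apply/eq_mxcol => -[i lt_il].
rewrite /weight; case: {-}_ / idP => [lt_il'|/(_ lt_il)//] /=.
by rewrite unvecK (bool_irrelevance lt_il' lt_il).
Qed.

End WeightVectors.

(** * The reparameterization as a linear map *)

Section Reparameterization.
Context {R : realType} {l : nat} {d : nat -> nat}.
Variables (Omega : forall i, 'M[R]_(d i + 1)) (Phi : forall i, 'M[R]_(d i)).

(* The Jacobian of zeta is the transpose of [zeta_tr], whose i-th diagonal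
   block is Omega_i *t Phi_{i+1}^T. *)
Definition zeta_tr_block i : 'M[R]_(block_size d i) :=
  tensmx (Omega i) (Phi i.+1)^T.

Definition zeta_tr : 'M[R]_(nparams l d) := \mxdiag_(i < l) zeta_tr_block i.

(** Blockwise this is $\mathrm{vec}(\Phi W \Omega) = (\Omega^\top \otimes \Phi)\,\mathrm{vec}(W)$,
    whose matrix is the transpose of [zeta_tr_block]. *)
Lemma zetaE (theta : 'cV[R]_(nparams l d)) :
  zeta Omega Phi theta = zeta_tr^T *m theta.
Proof.
rewrite -{2}(param_of_weightsK theta) /zeta /param_of_weights /zeta_tr tr_mxdiag.
rewrite mul_mxdiag_mxcol; apply/eq_mxcol => i.
by rewrite /zeta_tr_block trmx_tens trmxK vec_mulmx trmxK.
Qed.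

Lemma weight_zeta (theta : 'cV[R]_(nparams l d)) i :
  weight (zeta Omega Phi theta) i = Phi i.+1 *m weight theta i *m Omega i.
Proof.
have [lt_il|le_li] := ltnP i l; first by rewrite weight_param_of_weights.
(* Beyond the last layer both weights have the default value 0, so the relation is available at
   every step of the recursion on layers. *)
by rewrite !weight_ge// mulmx0 mul0mx.
Qed.

End Reparameterization.

(** * Forward passes of the two networks *)

Section Forward.
Context {R : realType} {l : nat} {d : nat -> nat}.
Variables (phi : nat -> R -> R).
Variables (Omega : forall i, 'M[R]_(d i + 1)) (Phi : forall i, 'M[R]_(d i)).
Notation net := (@original_arch R d phi).
Notation net' := (@transformed_arch R d phi Omega Phi).

(** By induction on the layer, [Phi] inside the transformed nonlinearity turns $s_i^\dagger$ into
    $s_i$. Clamps related by [Phi] cover both the plain activations and the output as a function of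
    a single $s_i$. *)
Lemma clamped_act_transformed (theta' : 'cV[R]_(nparams l d))
    (c c' : forall k, option 'cV[R]_(d k)) x i :
  (forall k, c k = omap (mulmx (Phi k)) (c' k)) ->
  clamped_act net' theta' c' x i =
  Omega i *m clamped_act net (zeta Omega Phi theta') c x i.
Proof.
move=> cE; elim: i => [//|i IHi] /=; congr (_ *m bar (map_mx _ _)).
rewrite cE; case: (c' i.+1) => [//|/=].
by rewrite IHi weight_zeta !mulmxA.
Qed.

Lemma act_transformed (theta' : 'cV[R]_(nparams l d)) x i :
  act net' theta' x i = Omega i *m act net (zeta Omega Phi theta') x i.
Proof. exact: clamped_act_transformed. Qed.

Lemma preact_transformed (theta' : 'cV[R]_(nparams l d)) x i :
  preact net (zeta Omega Phi theta') x i = Phi i.+1 *m preact net' theta' x i.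
Proof. by rewrite /preact weight_zeta act_transformed !mulmxA. Qed.

Hypothesis Omega_l : Omega l = 1%:M.

Lemma output_transformed (theta' : 'cV[R]_(nparams l d)) x :
  output net' theta' x = output net (zeta Omega Phi theta') x.
Proof. by rewrite /output act_transformed Omega_l mul1mx. Qed.

Lemma output_of_preact_transformed (theta' : 'cV[R]_(nparams l d)) x i
    (s : 'cV[R]_(d i.+1)) :
  output_of_preact net' theta' x s =
  output_of_preact net (zeta Omega Phi theta') x (Phi i.+1 *m s).
Proof.
rewrite /output_of_preact (@clamped_act_transformed _
  (@dfwith _ _ (@no_clamp R d) i.+1 (Some (Phi i.+1 *m s)))).
  by rewrite Omega_l mul1mx.
(* At [i.+1] the clamped values are related by [Phi]; elsewhere both clamps are [None]. *)
move=> k; case: dfwithP => [|j ne_j]; first by rewrite dfwithin.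
by rewrite dfwithout.
Qed.

End Forward.

(** * Chain rule for linear maps and linearity of expectations *)

Lemma gradient_mulmx (R : realType) m n (F : 'cV[R]_m -> R) (P : 'M[R]_(m, n))
    (v : 'cV[R]_n) :
  differentiable F (P *m v) ->
  gradient (fun u => F (P *m u)) v = P^T *m gradient F (P *m v).
Proof.
move=> dF; apply/matrixP => i j; rewrite [j]ord1 !mxE {j}.
have -> : 'D_(delta_mx i 0) (fun u => F (P *m u)) v =
          'D_(P *m delta_mx i 0) F (P *m v).
  (* Both derivatives are limits of the same difference quotients. *)
  by rewrite /derive /=; under eq_fun => h do rewrite mulmxDr -scalemxAr.
rewrite deriveE//.
(* The direction is a column of [P]; it is expanded in the standard basis to use the linearity of
   the differential. *)
have -> : P *m delta_mx i 0 = \sum_k P k i *: (delta_mx k 0 : 'cV[R]_m).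
  rewrite -colE [LHS]matrix_sum_delta; apply: eq_bigr => k _.
  by rewrite big_ord1 mxE.
rewrite linear_sum; apply: eq_bigr => k _.
by rewrite linearZ /= !mxE deriveE.
Qed.

(** A single sum over index pairs is the shape that [Rintegral_linear_comb] handles. *)
Lemma mulmx3E (R : realType) m n p q (A : 'M[R]_(m, n)) (M : 'M[R]_(n, p))
    (B : 'M[R]_(p, q)) i j :
  (A *m M *m B) i j = \sum_(k : 'I_n * 'I_p) (A i k.1 * B k.2 j) * M k.1 k.2.
Proof.
rewrite -(pair_bigA _ (fun k1 k2 => (A i k1 * B k2 j) * M k1 k2)) /=.
rewrite exchange_big mxE; apply: eq_bigr => k2 _; rewrite mxE big_distrl /=.
by apply: eq_bigr => k1 _; rewrite mulrAC.
Qed.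

(** The constant matrices leave both integrals by linearity. The relation is asked only almost
    surely, because the gradients are related only where the loss is differentiable. *)
Lemma model_expectation_mulmx (R : realType) (l : nat) (d : nat -> nat)
    (dY : measure_display) (Y : measurableType dY)
    (Rdist : 'cV[R]_(d l) -> probability Y R)
    (Q : probability (borel_cV R (d 0%N) * Y)%type R)
    (net net' : @architecture R d) (theta theta' : 'cV[R]_(nparams l d))
    (m n m' n' : nat) (A : 'M[R]_(m', m)) (B : 'M[R]_(n, n'))
    (M : 'cV[R]_(d 0%N) -> Y -> 'M[R]_(m, n))
    (M' : 'cV[R]_(d 0%N) -> Y -> 'M[R]_(m', n')) :
  cond_model Rdist net' theta' = cond_model Rdist net theta ->
  (forall k j, has_model_expectation Rdist Q net theta (fun x y => M x y k j)) ->
  {ae input_marginal Q, forall x, {ae cond_model Rdist net theta x, forall y,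
    M' x y = A *m M x y *m B}} ->
  (\matrix_(k, j) model_expectation Rdist Q net' theta' (fun x y => M' x y k j)) =
  A *m (\matrix_(k, j) model_expectation Rdist Q net theta (fun x y => M x y k j))
    *m B.
Proof.
move=> condE hasM M'E; apply/matrixP => k j.
rewrite mulmx3E mxE /model_expectation condE.
under [RHS]eq_bigr do rewrite mxE.
rewrite -Rintegral_linear_comb; last by move=> p; case: (hasM p.1 p.2).
apply: ae_eq_Rintegral.
have intM : {ae input_marginal Q, forall x, forall p : 'I_m * 'I_n,
    (cond_model Rdist net theta x).-integrable setT
      (EFin \o (fun y => M x y p.1 p.2))}.
  (* There are finitely many entries, so one null set of inputs serves for all of them. *)
  by apply: filter_forall => p; case: (hasM p.1 p.2).
apply: (filterS2 (ae_filter_ringOfSetsType (input_marginal Q)) _ intM M'E) =>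
  x intM_x M'E_x.
rewrite -Rintegral_linear_comb//; apply: ae_eq_Rintegral.
by apply: filterS M'E_x => y ->; rewrite mulmx3E.
Qed.

(** * Transformed objective, gradients and Fisher blocks *)

Section FisherBlocks.
Context {R : realType} {l : nat} {d : nat -> nat}.
Context {dY : measure_display} {Y : measurableType dY}.
Variables (Rdist : 'cV[R]_(d l) -> probability Y R).
Variables (r : Y -> 'cV[R]_(d l) -> R).
Variables (Q : probability (borel_cV R (d 0%N) * Y)%type R).
Variables (phi : nat -> R -> R).
Variables (Omega : forall i, 'M[R]_(d i + 1)) (Phi : forall i, 'M[R]_(d i)).
Hypothesis Omega_l : Omega l = 1%:M.
Notation net := (@original_arch R d phi).
Notation net' := (@transformed_arch R d phi Omega Phi).

Lemma cond_model_transformed (theta' : 'cV[R]_(nparams l d)) :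
  cond_model Rdist net' theta' = cond_model Rdist net (zeta Omega Phi theta').
Proof. by apply/funext => x; rewrite /cond_model output_transformed. Qed.

Lemma objective_transformed (theta' : 'cV[R]_(nparams l d)) :
  objective r Q net' theta' = objective r Q net (zeta Omega Phi theta').
Proof.
by apply: eq_Rintegral => -[x y] _; rewrite (output_transformed _ _ Omega_l).
Qed.

Lemma gradient_objective_transformed (theta' : 'cV[R]_(nparams l d)) :
  differentiable (objective r Q net) (zeta Omega Phi theta') ->
  gradient (objective r Q net') theta' =
  zeta_tr Omega Phi *m gradient (objective r Q net) (zeta Omega Phi theta').
Proof.
(* As an equality of functions, this exhibits the objective as a composite with a linear map, ready
   for the chain rule. *)
have -> : objective r Q net' =
    (fun u => objective r Q net ((zeta_tr Omega Phi)^T *m u)).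
  by apply/funext => u; rewrite -zetaE; exact: objective_transformed.
by rewrite zetaE => /gradient_mulmx ->; rewrite trmxK.
Qed.

(* Rewriting with equations that mention both [net] and [net'] may make
   unification unfold the two architectures; hence the explicit instances. *)
Lemma g_transformed (theta' : 'cV[R]_(nparams l d)) x y i :
  let theta := zeta Omega Phi theta' in
  differentiable (@loss_of_preact _ _ _ _ _ r net theta x y i)
    (preact net theta x i) ->
  g r net' theta' x y i = (Phi i.+1)^T *m g r net theta x y i.
Proof.
move=> theta diff_loss.
have lossE : @loss_of_preact _ _ _ _ _ r net' theta' x y i =
    (fun s => @loss_of_preact _ _ _ _ _ r net theta x y i (Phi i.+1 *m s)).
  apply/funext => s; apply: (congr1 (nll r y)).
  exact: output_of_preact_transformed.
have := @gradient_mulmx _ _ _ (@loss_of_preact _ _ _ _ _ r net theta x y i)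
  (Phi i.+1) (preact net' theta' x i).
rewrite -preact_transformed => /(_ diff_loss) <-.
by rewrite /g lossE.
Qed.

Variable theta' : 'cV[R]_(nparams l d).
Notation theta := (zeta Omega Phi theta').
Hypothesis def_theta : update_defined Rdist r Q net theta.

Lemma Abar_transformed i j : (i < l)%N -> (j < l)%N ->
  Abar Rdist Q net' theta' i j =
  Omega i *m Abar Rdist Q net theta i j *m (Omega j)^T.
Proof.
move=> lt_il lt_jl; have [_ _ hasA _] := def_theta.
apply: model_expectation_mulmx; first exact: cond_model_transformed.
  by move=> k m; exact: hasA.
apply: aeW => x; apply: aeW => y.
by rewrite !act_transformed trmx_mul !mulmxA.
Qed.

Lemma Gmat_transformed i j : (i < l)%N -> (j < l)%N ->
  Gmat Rdist r Q net' theta' i j =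
  (Phi i.+1)^T *m Gmat Rdist r Q net theta i j *m Phi j.+1.
Proof.
move=> lt_il lt_jl; have [_ diff_loss _ hasG] := def_theta.
apply: model_expectation_mulmx; first exact: cond_model_transformed.
  by move=> k m; exact: hasG.
(* [update_defined] grants differentiability of the loss only almost surely under the model. *)
apply: (@filterS _ _ (ae_filter_ringOfSetsType (input_marginal Q)) _ _ _
  diff_loss) => x; apply: filterS => y diff_xy.
rewrite (g_transformed (diff_xy _ lt_il)) (g_transformed (diff_xy _ lt_jl)).
by rewrite trmx_mul trmxK !mulmxA.
Qed.

(** The mixed-product rule gathers the outer [Omega] and [Phi] of the two Kronecker factors into
    [zeta_tr_block]. *)
Lemma Ftilde_transformed i j : (i < l)%N -> (j < l)%N ->
  Ftilde Rdist r Q net' theta' i j =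
  zeta_tr_block Omega Phi i *m Ftilde Rdist r Q net theta i j
    *m (zeta_tr_block Omega Phi j)^T.
Proof.
move=> lt_il lt_jl.
rewrite /Ftilde /zeta_tr_block (Abar_transformed lt_il lt_jl).
rewrite (Gmat_transformed lt_il lt_jl) trmx_tens trmxK.
by rewrite !tensmx_mul.
Qed.

(** * Equivariance of a single K-FAC step *)

Hypothesis Omega_unit : forall i, (i <= l)%N -> Omega i \in unitmx.
Hypothesis Phi_unit : forall i, (1 <= i <= l)%N -> Phi i \in unitmx.

Lemma zeta_tr_block_unitmx i : (i < l)%N -> zeta_tr_block Omega Phi i \in unitmx.
Proof.
move=> lt_il; apply: tens_unitmx; first exact/Omega_unit/ltnW.
by rewrite unitmx_tr; exact: Phi_unit.
Qed.

Lemma zeta_tr_unitmx : zeta_tr Omega Phi \in @unitmx R (nparams l d).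
Proof. by apply: mxdiag_unitmx => i; exact: zeta_tr_block_unitmx. Qed.

Lemma kfac_step_transformed (c : fisher_approx) (alpha : R) :
  inverses_exist Rdist r Q net c theta ->
  zeta Omega Phi (kfac_step Rdist r Q net' c alpha theta') =
  kfac_step Rdist r Q net c alpha theta.
Proof.
move=> inv_c; have [diff_h _ _ _] := def_theta.
have uZ := zeta_tr_unitmx; have uZt := uZ; rewrite -unitmx_tr in uZt.
rewrite /kfac_step.
rewrite (invmx_curvature_congr zeta_tr_block_unitmx Ftilde_transformed inv_c).
rewrite -/(zeta_tr Omega Phi) (gradient_objective_transformed diff_h).
(* The inverse of [zeta_tr] cancels against the gradient's factor; the remaining inverse transpose
   cancels against the matrix of [zeta]. *)
rewrite -!mulmxA mulKmx// zetaE mulmxBr -scalemxAr trmx_inv.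
by rewrite mulKVmx// -zetaE.
Qed.

End FisherBlocks.

(** * Comparison of the two optimization paths *)

Theorem corollary2 (R : realType) (l : nat) (d : nat -> nat)
    (dY : measure_display) (Y : measurableType dY)
    (mu : {measure set Y -> \bar R})
    (Rdist : 'cV[R]_(d l) -> probability Y R) (r : Y -> 'cV[R]_(d l) -> R)
    (Q : probability (borel_cV R (d 0%N) * Y)%type R)
    (phi : nat -> R -> R)
    (Omega : forall i, 'M[R]_(d i + 1)) (Phi : forall i, 'M[R]_(d i))
    (c : fisher_approx) (lr : @learning_rule R l d)
    (theta theta' : nat -> 'cV[R]_(nparams l d)) :
  let net : architecture d := original_arch phi in
  let net' : architecture d := transformed_arch phi Omega Phi in
  is_density mu Rdist r ->
  (forall i, (i <= l)%N -> Omega i \in unitmx) ->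
  (forall i, (1 <= i <= l)%N -> Phi i \in unitmx) ->
  Omega l = 1%:M ->
  theta 0%N = zeta Omega Phi (theta' 0%N) ->
  kfac_run Rdist r Q net lr c theta ->
  kfac_run Rdist r Q net' lr c theta' ->
  (forall k, update_defined Rdist r Q net (theta k)) ->
  (forall k, inverses_exist Rdist r Q net c (theta k)) ->
  forall k, cond_model Rdist net (theta k) = cond_model Rdist net' (theta' k).
Proof.
move=> net net' _ Omega_unit Phi_unit Omega_l theta0E run run' def inv_c.
have thetaE : forall k, theta k = zeta Omega Phi (theta' k).
  (* Strong induction, because the learning rate may depend on all iterations so far. *)
  elim/ltn_ind => -[//|k] IHk.
  have stepE j alpha : (j <= k)%N ->
      zeta Omega Phi (kfac_step Rdist r Q net' c alpha (theta' j)) =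
      kfac_step Rdist r Q net c alpha (theta j).
    move=> le_jk; have := def j; have := inv_c j; rewrite IHk// => inv_j def_j.
    exact: kfac_step_transformed.
  (* Trial steps of either run compute the same functions at every rate [alpha], so [lr] returns the
     same rate for both. *)
  have outputE : mkseq (fun j alpha =>
        output net' (kfac_step Rdist r Q net' c alpha (theta' j))) k.+1 =
      mkseq (fun j alpha =>
        output net (kfac_step Rdist r Q net c alpha (theta j))) k.+1.
    apply/eq_in_map => j; rewrite mem_iota ltnS => le_jk.
    apply/funext => alpha; apply/funext => x.
    apply: (etrans (output_transformed phi Phi Omega_l _ _)).
    by rewrite (stepE _ _ le_jk).
  by rewrite run' outputE (stepE _ _ (leqnn k)) run.
by move=> k; rewrite thetaE; exact/esym/cond_model_transformed.
Qed.
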